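(* Let $\mathbf{X}$ be a real vector space, $\mathbf{Z}$ a nonempty set, and $\phi:\mathbf{Z}\times\mathbf{X}\to\mathbf{Z}$ a function with $\phi(z,0)=z$ for all $z\in\mathbf{Z}$. Let $f:\mathbf{Z}\to\overline{\mathbb{R}}$ be any function. Then the limit \[ A^\infty f(z):=\lim_{n\to\infty}A^nf(z) \] exists in $\overline{\mathbb{R}}$ for every $z\in\mathbf{Z}$, and the function $A^\infty f:\mathbf{Z}\to\overline{\mathbb{R}}$ is the smallest fixed point of $A$ dominating $f$; that is, $A(A^\infty f)=A^\infty f$, $A^\infty f\ge f$, and every $g:\mathbf{Z}\to\overline{\mathbb{R}}$ with $Ag=g$ and $g\ge f$ satisfies $g\ge A^\infty f$.
   Context: $\overline{\mathbb{R}}=[-\infty,\infty]$, with the convention $\infty-\infty=-\infty$, used in particular in the definition of concavity: $\psi:\mathbf{X}\to\overline{\mathbb{R}}$ is concave if $\psi(\lambda x+(1-\lambda)y)\ge\lambda\psi(x)+(1-\lambda)\psi(y)$ for all $x,y\in\mathbf{X}$, $\lambda\in(0,1)$. For $h:\mathbf{X}\to\overline{\mathbb{R}}$, the concave envelope is $h^\sharp(x)=\inf\{\psi(x)\mid\psi:\mathbf{X}\to\overline{\mathbb{R}}\text{ concave},\ \psi\ge h\}$. The operator $A$ maps a function $g:\mathbf{Z}\to\overline{\mathbb{R}}$ to the function $Ag:\mathbf{Z}\to\overline{\mathbb{R}}$, $Ag(z)=[g\circ\phi(z,\cdot)]^\sharp(0)$, i.e. the concave envelope of $d\mapsto g(\phi(z,d))$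 on $\mathbf{X}$, evaluated at $d=0$. $A^n$ is the $n$-fold composition of $A$. Inequalities between functions are pointwise. *)

(* Defs.v *)
From HB Require Import structures.
From mathcomp Require Import all_boot all_order all_algebra.
From mathcomp Require Import all_classical all_reals all_analysis.

Set Implicit Arguments.
Unset Strict Implicit.
Unset Printing Implicit Defensive.

Import Order.TTheory GRing.Theory Num.Theory.

Local Open Scope classical_set_scope.
Local Open Scope ring_scope.
Local Open Scope ereal_scope.

(* The addition of [\bar R] satisfies [+oo + -oo = -oo], which is the intended
   convention in the inequality below. *)
Definition econcave (R : realType) (X : lmodType R) (psi : X -> \bar R) : Prop :=
  forall (x y : X) (t : R), (0 < t < 1)%R ->
    t%:E * psi x + (1 - t)%:E * psi y <= psi (t *: x + (1 - t) *: y)%R.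

Definition concave_envelope (R : realType) (X : lmodType R) (h : X -> \bar R)
    (x : X) : \bar R :=
  ereal_inf [set psi x | psi in
    [set psi : X -> \bar R | econcave psi /\ forall y, h y <= psi y]].

Definition envop (R : realType) (X : lmodType R) (Z : Type) (phi : Z -> X -> Z)
    (g : Z -> \bar R) (z : Z) : \bar R :=
  concave_envelope (fun d : X => g (phi z d)) 0%R.

Definition envop_lim (R : realType) (X : lmodType R) (Z : Type)
    (phi : Z -> X -> Z) (f : Z -> \bar R) (z : Z) : \bar R :=
  limn (fun n : nat => iter n (envop phi) f z).

(* Main.v *)
(* The iterates increase because phi(z, 0) = z, so A^oo f is their supremum. The
   point is that the concave envelope commutes with increasing limits: an
   increasing limit of concave functions is concave, where the convention
   +oo - oo = -oo makes the inequality trivial as soon as one of the two values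
   is -oo. *)
Require Import Defs.
From HB Require Import structures.
From mathcomp Require Import all_boot all_order all_algebra.
From mathcomp Require Import all_classical all_reals all_analysis.

Set Implicit Arguments.
Unset Strict Implicit.
Unset Printing Implicit Defensive.

Import Order.TTheory GRing.Theory Num.Theory.

Local Open Scope classical_set_scope.
Local Open Scope ring_scope.
Local Open Scope ereal_scope.

Lemma le_concave_envelope_self (R : realType) (X : lmodType R)
    (h : X -> \bar R) (x : X) : h x <= concave_envelope h x.
Proof. by apply: le_ereal_inf_tmp => _ [psi [_ hpsi] <-]. Qed.

Lemma concave_envelope_le (R : realType) (X : lmodType R)
    (h psi : X -> \bar R) (x : X) :
  econcave psi -> (forall y, h y <= psi y) -> concave_envelope h x <= psi x.
Proof. by move=> cpsi hpsi; apply: ereal_inf_lbound; exists psi. Qed.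

(** Each concave majorant [psi] of [h] lies above the envelope at [x] and [y], so its own concavity
    inequality bounds the left side; then take the infimum over [psi]. *)
Lemma econcave_concave_envelope (R : realType) (X : lmodType R)
    (h : X -> \bar R) : econcave (concave_envelope h).
Proof.
move=> x y t /[dup] t01 /andP[t0 t1].
apply: le_ereal_inf_tmp => _ [psi [cpsi hpsi] <-].
apply: le_trans (cpsi x y t t01).
apply: leeD; apply: lee_wpmul2l;
  rewrite ?lee_fin ?subr_ge0 ?(ltW t0) ?(ltW t1)//;
  exact: concave_envelope_le.
Qed.

(** The envelope of [k] is itself a concave majorant of [h]. *)
Lemma concave_envelope_homo (R : realType) (X : lmodType R)
    (h k : X -> \bar R) (x : X) :
  (forall y, h y <= k y) -> concave_envelope h x <= concave_envelope k x.
Proof.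
move=> hk; apply: concave_envelope_le; first exact: econcave_concave_envelope.
by move=> y; apply: le_trans (hk y) (le_concave_envelope_self _ _).
Qed.

Lemma econcave_nondecreasing_lim (R : realType) (X : lmodType R)
    (psi : nat -> X -> \bar R) :
  (forall n, econcave (psi n)) ->
  (forall x, nondecreasing_seq (psi ^~ x)) ->
  econcave (fun x => limn (psi ^~ x)).
Proof.
move=> cpsi ndpsi x y t /[dup] t01 /andP[t0 t1].
have cvg z : psi ^~ z @ \oo --> limn (psi ^~ z).
  exact: ereal_nondecreasing_is_cvgn.
have s0 : (0 < 1 - t)%R by rewrite subr_gt0.
have [->|xNy] := eqVneq (limn (psi ^~ x)) -oo.
  by rewrite gt0_muleNy ?lte_fin// addNye leNye.
have [->|yNy] := eqVneq (limn (psi ^~ y)) -oo.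
  by rewrite gt0_muleNy ?lte_fin// addeNy leNye.
have scaleNy (c : R) (a : \bar R) : (0 < c)%R -> a != -oo -> c%:E * a != -oo.
  by move=> c0; case: a => // _; rewrite gt0_muley ?lte_fin.
(* Both limits now differ from [-oo] and both weights are positive, so neither limiting summand is
   [-oo]: the sum avoids [+oo + -oo], where addition is not continuous. *)
have cvgL : t%:E * psi n x + (1 - t)%:E * psi n y @[n --> \oo] -->
    t%:E * limn (psi ^~ x) + (1 - t)%:E * limn (psi ^~ y).
  apply: cvgeD; last 2 first.
  - exact: cvgeZl.
  - exact: cvgeZl.
  by rewrite /adde_def !negb_and !scaleNy ?orbT.
rewrite -(cvg_lim (@ereal_hausdorff R) cvgL).
apply: lee_lim; [by apply/cvg_ex; eexists; exact: cvgL|exact: cvg|].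
by apply: nearW => n; exact: cpsi.
Qed.

Lemma concave_envelope_nondecreasing_lim_le (R : realType) (X : lmodType R)
    (h : nat -> X -> \bar R) (x : X) :
  (forall y, nondecreasing_seq (h ^~ y)) ->
  concave_envelope (fun y => limn (h ^~ y)) x <=
    limn (fun n => concave_envelope (h n) x).
Proof.
move=> ndh.
pose E n := concave_envelope (h n).
have ndE y : nondecreasing_seq (E ^~ y).
  by move=> m n mn; apply: concave_envelope_homo => z; exact: ndh.
(* The limit of the envelopes is the competitor: it is concave as an increasing limit of concave
   functions, and it dominates the limit of the [h n] termwise. *)
apply: (@concave_envelope_le _ _ _ (fun y => limn (E ^~ y))).
  apply: (@econcave_nondecreasing_lim _ _ E) => // n.
  exact: econcave_concave_envelope.
move=> y; apply: lee_lim; [exact: ereal_nondecreasing_is_cvgn..|].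
by apply: nearW => n; exact: le_concave_envelope_self.
Qed.

Lemma envop_homo (R : realType) (X : lmodType R) (Z : Type) (phi : Z -> X -> Z)
    (g k : Z -> \bar R) :
  (forall z, g z <= k z) -> forall z, envop phi g z <= envop phi k z.
Proof. by move=> gk z; apply: concave_envelope_homo. Qed.

Lemma le_envop (R : realType) (X : lmodType R) (Z : Type) (phi : Z -> X -> Z)
    (phi0 : forall z, phi z 0%R = z) (g : Z -> \bar R) (z : Z) :
  g z <= envop phi g z.
Proof. by rewrite -{1}(phi0 z); exact: le_concave_envelope_self. Qed.

Theorem theorem3p3 (R : realType) (X : lmodType R) (Z : Type)
    (Z_nonempty : inhabited Z) (phi : Z -> X -> Z)
    (phi0 : forall z : Z, phi z 0%R = z) (f : Z -> \bar R) :
  [/\ forall z : Z, cvgn (fun n : nat => iter n (envop phi) f z),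
      envop phi (envop_lim phi f) = envop_lim phi f,
      forall z : Z, f z <= envop_lim phi f z
    & forall g : Z -> \bar R, envop phi g = g -> (forall z : Z, f z <= g z) ->
        forall z : Z, envop_lim phi f z <= g z].
Proof.
pose a z n := iter n (envop phi) f z.
have nda z : nondecreasing_seq (a z).
  by apply/nondecreasing_seqP => n; exact: le_envop.
have cva z : cvgn (a z) by exact: ereal_nondecreasing_is_cvgn.
have leFa z n : a z n <= envop_lim phi f z.
  by apply: lime_ge; [exact: cva|exists n => // m; exact: nda].
split => //.
- apply/funext => z; apply/eqP; rewrite eq_le le_envop// andbT.
  (* Along [d], the functions [a (phi z d) n] increase in [n], so the limit can be pulled out of the
     envelope at 0. *)
  apply: le_trans (concave_envelope_nondecreasing_lim_le _ _) _.
    by move=> y; exact: nda.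
  apply: lime_le.
    apply: ereal_nondecreasing_is_cvgn => m n mn.
    by apply: concave_envelope_homo => d; exact: nda.
  (* The envelope of the [n]-th iterate is the iterate of index [n.+1], hence the shift. *)
  by apply: nearW => n; exact: (leFa z n.+1).
- by move=> z; exact: (leFa z 0%N).
- move=> g Ag fg z; apply: lime_le; first exact: cva.
  (* Every iterate stays below [g]: applying the monotone operator to the induction hypothesis
     leaves the fixed point [g] unchanged. *)
  apply: nearW => n; elim: n z => [|n IH] z /=; first exact: fg.
  by rewrite -Ag; exact: envop_homo.
Qed.
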